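(* For every computably enumerable set $C\subseteq\mathbb{N}$ there exist two disjoint regainingly approximable sets $A,B\subseteq\mathbb{N}$ with $C=A\cup B$.
   Context: A real number $\alpha$ is regainingly approximable if there exists a computable nondecreasing sequence of rational numbers $(a_n)_n$ converging to $\alpha$ such that $\alpha-a_n<2^{-n}$ holds for infinitely many $n\in\mathbb{N}$. For $A\subseteq\mathbb{N}$ let $2^{-A}:=\sum_{a\in A}2^{-(a+1)}$. A set $A\subseteq\mathbb{N}$ is called regainingly approximable if it is computably enumerable and the real number $2^{-A}$ is regainingly approximable. *)

(* Defs.v *)
From HB Require Import structures.
From mathcomp Require Import all_boot all_order all_algebra.
From mathcomp Require Import all_classical all_reals all_analysis.
Import Order.TTheory GRing.Theory Num.Theory.
Import numFieldNormedType.Exports.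

Set Implicit Arguments.
Unset Strict Implicit.
Unset Printing Implicit Defensive.

Local Open Scope classical_set_scope.
Local Open Scope ring_scope.

(* Programs for the k-ary partial recursive (mu-recursive) functions. *)
Inductive recprog : nat -> Type :=
| RecZero k : recprog k
| RecSucc : recprog 1
| RecProj k : 'I_k -> recprog k
| RecComp k m : recprog m -> ('I_m -> recprog k) -> recprog k
| RecPrim k : recprog k -> recprog k.+2 -> recprog k.+1
| RecMin k : recprog k.+1 -> recprog k.

Fixpoint iter_graph (base : nat -> Prop) (step : nat -> nat -> nat -> Prop)
    (n y : nat) : Prop :=
  if n is n'.+1 then exists2 z, iter_graph base step n' z & step n' z y
  else base y.

(* [computes c v y]: the program c halts on the input v with output y.
   For RecPrim, the recursion is on the first argument, and the step program
   receives the predecessor, the previous value and the parameters.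
   For RecMin, the values at all arguments below y must be defined and
   positive. *)
Fixpoint computes (k : nat) (c : recprog k) : k.-tuple nat -> nat -> Prop :=
  match c in recprog k return k.-tuple nat -> nat -> Prop with
  | RecZero k => fun _ y => y = 0%N
  | RecSucc => fun v y => y = (thead v).+1
  | RecProj k i => fun v y => y = tnth v i
  | RecComp k m f g => fun v y =>
      exists2 w : m.-tuple nat,
        forall i, computes (g i) v (tnth w i) & computes f w y
  | RecPrim k f g => fun v =>
      iter_graph (computes f (behead_tuple v))
        (fun n z => computes g (cons_tuple n (cons_tuple z (behead_tuple v))))
        (thead v)
  | RecMin k f => fun v y =>
      computes f (cons_tuple y v) 0%N /\
      forall z, (z < y)%N -> exists t, computes f (cons_tuple z v) t.+1
  end.

Lemma computes_fun k (c : recprog k) v y y' :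
  computes c v y -> computes c v y' -> y = y'.
Proof.
elim: c v y y' => {k}
  [k v y y' -> -> //|v y y' -> -> //|k i v y y' -> -> //
  |k m f IHf g IHg v y y' /= [w gw fw] [w' gw' fw']
  |k f IHf g IHg v y y' /=|k f IHf v y y' /= [fy Hy] [fy' Hy']].
- apply: (IHf w) => //; suff -> : w = w' by [].
  by apply: eq_from_tnth => i; apply: IHg (gw i) (gw' i).
- elim: (thead v) y y' => [|n IHn] y y'; first exact: IHf.
  move=> [z zP gy] [z' zP' gy']; apply: IHg gy _.
  by rewrite (IHn _ _ zP zP').
- case: (ltngtP y y') => [lt|lt|//].
  + by have [t ft] := Hy' _ lt; have := IHf _ _ _ fy ft.
  + by have [t ft] := Hy _ lt; have := IHf _ _ _ fy' ft.
Qed.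

Definition computable (f : nat -> nat) : Prop :=
  exists c : recprog 1, forall n, computes c [tuple n] (f n).

Definition computably_enumerable (A : set nat) : Prop :=
  A = set0 \/ exists2 f : nat -> nat, computable f & A = range f.

Definition computable_rat_seq (a : nat -> rat) : Prop :=
  exists p q r : nat -> nat,
    [/\ computable p, computable q, computable r &
        forall n, a n = ((p n)%:R - (q n)%:R) / (r n).+1%:R].

Definition regainingly_approximable (R : realType) (alpha : R) : Prop :=
  exists a : nat -> rat,
    [/\ computable_rat_seq a,
        nondecreasing_seq a,
        ratr (a n) @[n --> \oo] --> alpha &
        infinite_set [set n : nat | alpha - ratr (a n) < 2 ^- n]].

Definition set_real (R : realType) (A : set nat) : R :=
  limn (series (fun a : nat => if `[< A a >] then 2 ^- a.+1 else 0 : R)).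

Lemma is_cvg_set_real (R : realType) (A : set nat) :
  cvgn (series (fun a : nat => if `[< A a >] then 2 ^- a.+1 else 0 : R)).
Proof.
apply: (@series_le_cvg _ _ (fun a => 2^-1 * 2^-1 ^+ a)) => [n|n|n|].
- by case: ifP => // _; rewrite invr_ge0 exprn_ge0.
- by rewrite mulr_ge0 ?exprn_ge0 ?invr_ge0.
- by case: ifP => _; rewrite -exprS ?exprVn // invr_ge0 exprn_ge0.
- apply: is_cvg_geometric_series.
  by rewrite ger0_norm ?invr_ge0 // invf_lt1 // ltr1n.
Qed.

Definition regainingly_approximable_set (R : realType) (A : set nat) : Prop :=
  computably_enumerable A /\ regainingly_approximable (set_real R A).

(* Main.v *)
(* Let f enumerate C.  Put n_0 = 0 and let n_{i+1} > n_i be the first stage by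
   which all elements of C below n_i have been enumerated.  An element x < n_i
   that first appears at a stage t >= n_i satisfies n_{i-1} <= x < n_i, and at
   such a stage n_0, ..., n_i are already known correctly, so the index i can be
   computed from x and t.  Sending the elements of even index to one part and
   those of odd index to the other guarantees that no element below n_i enters
   the part of the parity opposite to i after stage n_i.  Hence for infinitely
   many n the approximation at stage n of the binary expansion of each part is
   correct on its first n digits, and so has error at most 2^-n. *)

Require Import Defs.
From HB Require Import structures.
From mathcomp Require Import all_boot all_order all_algebra.
From mathcomp Require Import all_classical all_reals all_analysis.
Local Open Scope classical_set_scope.

Set Implicit Arguments.
Unset Strict Implicit.
Unset Printing Implicit Defensive.

(** * Closure properties of recursive functions *)

Local Notation "v `_ i" := (nth 0%N v i) : nat_scope.

(* F takes lists rather than k-tuples, so that the i-th argument is [v`_i] with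
   a default value independent of v; then [(x :: v)`_i.+1] and [v`_i] are
   convertible. *)
Definition recursive (k : nat) (F : seq nat -> nat) : Prop :=
  exists c : recprog k, forall v : k.-tuple nat, computes c v (F v).

Lemma eq_recursive k F G : F =1 G -> recursive k F -> recursive k G.
Proof. by move=> FG [c cP]; exists c => v; rewrite -FG. Qed.

Lemma computableE h : computable h <-> recursive 1 (fun v => h v`_0)%N.
Proof.
split=> -[c cP]; exists c; last by move=> n; apply: (cP [tuple n]).
move=> v; have -> : v = [tuple thead v] by apply: val_inj; case: v => -[|x []].
exact: cP.
Qed.

Lemma recursive_var k i : (i < k)%N -> recursive k (fun v => v`_i)%N.
Proof.
by move=> ik; exists (RecProj (Ordinal ik)) => v /=; rewrite (tnth_nth 0%N).
Qed.

Lemma recursive_subst k F (Gs : seq (seq nat -> nat)) :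
  recursive (size Gs) F ->
  (forall i, (i < size Gs)%N -> recursive k (nth (fun=> 0%N) Gs i)) ->
  recursive k (fun v => F [seq G v | G <- Gs]).
Proof.
move=> [c cP] GP.
have /fin_all_exists[g gP] (i : 'I_(size Gs)) : exists d : recprog k,
    forall v : k.-tuple nat, computes d v (nth (fun=> 0%N) Gs i v).
  exact: GP.
exists (RecComp c g) => v /=; exists (map_tuple (fun G : seq nat -> nat => G v) (in_tuple Gs)).
  move=> i; rewrite tnth_map (tnth_nth (fun=> 0%N)); exact: gP.
exact: cP.
Qed.

Lemma recursive_app1 k h F : recursive 1 (fun v => h v`_0)%N ->
  recursive k F -> recursive k (fun v => h (F v)).
Proof.
move=> hP FP; apply: (recursive_subst (Gs := [:: F]) hP).
by case.
Qed.

Lemma recursive_app2 k h F G : recursive 2 (fun v => h v`_0 v`_1)%N ->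
  recursive k F -> recursive k G -> recursive k (fun v => h (F v) (G v)).
Proof.
move=> hP FP GP; apply: (recursive_subst (Gs := [:: F; G]) hP).
by case=> [|[|]].
Qed.

Lemma recursive_succ k F : recursive k F -> recursive k (fun v => (F v).+1).
Proof.
move=> FP; apply: (recursive_app1 (h := succn) _ FP); exists RecSucc => v /=.
by rewrite /thead (tnth_nth 0%N).
Qed.

Lemma recursive_const k n : recursive k (fun=> n).
Proof.
elim: n => [|n IHn]; first by exists (RecZero k).
exact: recursive_succ.
Qed.

Lemma recursive_iteri k n b st :
  recursive k n -> recursive k b -> recursive k.+2 st ->
  recursive k (fun v => iteri (n v) (fun i z => st (i :: z :: v)) (b v)).
Proof.
move=> nP [c cP] [d dP].
have prim : recursive k.+1 (fun w => iteri w`_0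
    (fun i z => st [:: i, z & behead w]) (b (behead w)))%N.
  exists (RecPrim c d) => w /=; rewrite -(tnth_nth 0%N w ord0) -/(thead w).
  elim: (thead w) => [|i IHi] /=; first exact: cP.
  exists (iteri i (fun i z => st [:: i, z & behead w]) (b (behead w))) => //.
  exact: (dP (cons_tuple i (cons_tuple _ (behead_tuple w)))).
(* [prim] recurses on its first argument, so [n v] is put in front and projections reproduce [v] as
   the list of parameters. *)
have := @recursive_subst k _ (n :: [seq (fun v : seq nat => v`_i)%N | i <- iota 0 k]).
rewrite /= size_map size_iota => /(_ _ prim) sub.
have {sub prim} [[|i] /=|e eP] := sub.
- by [].
- rewrite ltnS => ik; rewrite (nth_map 0%N) ?size_iota // nth_iota //.
  exact: recursive_var.
exists e => v; move: (eP v).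
rewrite -map_comp (_ : map _ _ = v) //.
by rewrite -[RHS](mkseq_nth 0%N) size_tuple.
Qed.

Lemma recursive_min k (P : pred (seq nat)) (M : seq nat -> nat) :
  recursive k.+1 (fun w => ~~ P w) ->
  (forall v, P (M v :: v)) -> (forall v y, P (y :: v) -> (M v <= y)%N) ->
  recursive k M.
Proof.
move=> [c cP] MP Mmin; exists (RecMin c) => v /=; split.
  by have := cP (cons_tuple (M v) v); rewrite /= MP.
(* Below the minimum [~~ P] has the value 1, the successor of 0, as [RecMin] demands. *)
move=> z zM; exists 0%N; have := cP (cons_tuple z v).
rewrite /= (_ : P (z :: v) = false) //.
by apply: contraTF zM => /Mmin; rewrite -leqNgt.
Qed.

Lemma recursive_add k F G :
  recursive k F -> recursive k G -> recursive k (fun v => F v + G v)%N.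
Proof.
move=> FP GP; apply: (recursive_app2 (h := addn) _ FP GP).
apply: (eq_recursive (F := fun v => iteri v`_1 (fun _ z => z.+1) v`_0)%N).
  by move=> v; elim: (v`_1)%N => [|n /= ->]; rewrite ?addn0 ?addnS.
apply: (recursive_iteri (st := fun w => (w`_1).+1%N));
  by [apply: recursive_var|apply/recursive_succ/recursive_var].
Qed.

Lemma recursive_mul k F G :
  recursive k F -> recursive k G -> recursive k (fun v => F v * G v)%N.
Proof.
move=> FP GP; apply: (recursive_app2 (h := muln) _ FP GP).
apply: (eq_recursive (F := fun v => iteri v`_0 (fun _ z => v`_1 + z) 0)%N).
  by move=> v; elim: (v`_0)%N => [//|n /= ->].
apply: (recursive_iteri (st := fun w => (w`_3 + w`_1)%N)).
- exact: recursive_var.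
- exact: recursive_const.
- by apply: recursive_add; apply: recursive_var.
Qed.

Lemma recursive_sub k F G :
  recursive k F -> recursive k G -> recursive k (fun v => F v - G v)%N.
Proof.
move=> FP GP; apply: (recursive_app2 (h := subn) _ FP GP).
apply: (eq_recursive (F := fun v => iteri v`_1 (fun _ z => z.-1) v`_0)%N).
  by move=> v; elim: (v`_1)%N => [|n /= ->]; rewrite ?subn0 ?subnS.
apply: (recursive_iteri (st := fun w => (w`_1).-1%N)); try exact: recursive_var.
apply: (recursive_app1 (h := predn)); last exact: recursive_var.
(* The predecessor is the last index that the iteration passes through, and 0 if there is none. *)
apply: (eq_recursive (F := fun v => iteri v`_0 (fun i _ => i) 0)%N).
  by move=> v; case: (v`_0)%N.
apply: (recursive_iteri (st := fun w => w`_0)%N); try exact: recursive_var.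
exact: recursive_const.
Qed.

Lemma recursive_neg k (P : pred (seq nat)) :
  recursive k (fun v => P v) -> recursive k (fun v => ~~ P v).
Proof.
move=> PP; apply: eq_recursive (recursive_sub (recursive_const k 1) PP) => v.
by case: (P v).
Qed.

Lemma recursive_and k (P Q : pred (seq nat)) :
  recursive k (fun v => P v) -> recursive k (fun v => Q v) ->
  recursive k (fun v => P v && Q v).
Proof.
move=> PP QP; apply: eq_recursive (recursive_mul PP QP) => v.
by rewrite mulnb.
Qed.

Lemma recursive_leq k F G :
  recursive k F -> recursive k G -> recursive k (fun v => F v <= G v)%N.
Proof.
move=> FP GP.
apply: eq_recursive (recursive_sub (recursive_const k 1) (recursive_sub FP GP)).
by move=> v; rewrite /leq; case: (F v - G v)%N.
Qed.

Lemma recursive_eq k F G :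
  recursive k F -> recursive k G -> recursive k (fun v => F v == G v).
Proof.
move=> FP GP; apply: eq_recursive
  (recursive_and (recursive_leq FP GP) (recursive_leq GP FP)) => v.
by rewrite -eqn_leq.
Qed.

Lemma recursive_odd k F : recursive k F -> recursive k (fun v => odd (F v)).
Proof.
move=> FP; apply: (recursive_app1 (h := fun n => odd n) _ FP).
apply: (eq_recursive (F := fun v => iteri v`_0 (fun _ z => 1 - z) 0)%N).
  by move=> v; elim: (v`_0)%N => [//|n /= ->]; case: (odd n).
apply: (recursive_iteri (st := fun w => (1 - w`_1)%N)).
- exact: recursive_var.
- exact: recursive_const.
- by apply: recursive_sub; [apply: recursive_const|apply: recursive_var].
Qed.

Lemma recursive_has k n (P : pred (seq nat)) :
  recursive k n -> recursive k.+1 (fun w => P w) ->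
  recursive k (fun v => has (fun u => P (u :: v)) (iota 0 (n v))).
Proof.
(* The accumulator is a disjunction, expressed by negation and conjunction. *)
move=> nP PP; apply: (eq_recursive (F := fun v =>
    iteri (n v) (fun i z => ~~ ((z == 0) && ~~ P (i :: v))) 0)%N).
  move=> v; elim: (n v) => [//|m IHm].
  by rewrite -addn1 iotaD has_cat /= addn1 /= IHm orbF; case: has; case: (P _).
apply: (recursive_iteri
  (st := fun w => ~~ ((w`_1 == 0) && ~~ P (w`_0 :: behead (behead w))))%N) => //.
  exact: recursive_const.
apply/recursive_neg/recursive_and.
  by apply: recursive_eq; [apply: recursive_var|apply: recursive_const].
apply: recursive_neg.
have [c cP] := PP.
(* These projections skip position 1, which holds the accumulator. *)
exists (RecComp c (fun i : 'I_k.+1 =>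
  RecProj (if i == ord0 then ord0 else lift ord0 i))) => v /=.
exists (cons_tuple (thead v) (behead_tuple (behead_tuple v))) => [i|].
  rewrite !(tnth_nth 0%N); have [->|] := eqVneq i ord0.
    by rewrite /thead (tnth_nth 0%N).
  by case: i => -[//|i] ik _ /=; rewrite !nth_behead.
have := cP (cons_tuple (thead v) (behead_tuple (behead_tuple v))).
case: v => -[|x [|y v]] //= sz; rewrite /thead (tnth_nth 0%N) //.
Qed.

(** * Markers and the splitting of the range of [f] *)

Section Splitting.
Variable f : nat -> nat.

Definition seen (u x : nat) : bool := has (fun v => f v == x) (iota 0 u).

(** The conjunct [m < u] makes the markers strictly increasing. *)
Definition settled (m t u : nat) : bool :=
  (m < u)%N && ~~ has (fun s => (f s < m)%N && ~~ seen u (f s)) (iota 0 t).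

Lemma seenP u x : reflect (exists2 v, (v < u)%N & f v = x) (seen u x).
Proof.
apply: (iffP hasP) => [[v] | [v vu fv]].
  by rewrite mem_iota => /= vu /eqP; exists v.
by exists v; [rewrite mem_iota | apply/eqP].
Qed.

Lemma seen_mono u u' x : (u <= u')%N -> seen u x -> seen u' x.
Proof.
by move=> uu' /seenP[v vu fv]; apply/seenP; exists v => //; apply: leq_trans uu'.
Qed.

Lemma settledP m t u : reflect
  ((m < u)%N /\ forall s, (s < t)%N -> (f s < m)%N -> seen u (f s))
  (settled m t u).
Proof.
apply: (iffP andP) => -[mu sP]; split=> //.
  move=> s st fs; apply: contraNT sP => nseen; apply/hasP; exists s.
    by rewrite mem_iota.
  by rewrite fs.
apply/hasPn => s; rewrite mem_iota => /= st; rewrite negb_and negbK -implybE.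
by apply/implyP; apply: sP.
Qed.

Lemma settled_ex m t : exists u, settled m t u.
Proof.
exists (maxn m.+1 t); apply/settledP; split=> [|s st _]; first exact: leq_maxl.
by apply/seenP; exists s => //; apply: leq_trans st (leq_maxr _ _).
Qed.

(* Approximation at stage t of the stage by which f has enumerated all its values
   below m; it only searches among the stages after m. *)
Definition settle (m t : nat) : nat := ex_minn (settled_ex m t).

Lemma settle_settled m t : settled m t (settle m t).
Proof. by rewrite /settle; case: ex_minnP. Qed.

Lemma settle_min m t u : settled m t u -> (settle m t <= u)%N.
Proof. by rewrite /settle; case: ex_minnP => v _; apply. Qed.

(* Approximation at stage t of the number n_i of the introductory comment. *)
Definition marker (t i : nat) : nat := iteri i (fun _ m => settle m t) 0.

Lemma marker_lt t i : (marker t i < marker t i.+1)%N.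
Proof. by have /settledP[] := settle_settled (marker t i) t. Qed.

Lemma marker_homo t : {homo marker t : i j / (i <= j)%N}.
Proof.
apply: homo_leq => [x|y x z|i]; [exact: leqnn|exact: leq_trans|].
exact/ltnW/marker_lt.
Qed.

Lemma leq_marker t i : (i <= marker t i)%N.
Proof. by elim: i => [//|i IHi]; apply: leq_ltn_trans (marker_lt t i). Qed.

Lemma first_ex x s : f s = x -> exists v, f v == x.
Proof. by exists s; apply/eqP. Qed.

Definition first (s : nat) : nat := ex_minn (first_ex (erefl (f s))).

Lemma f_first s : f (first s) = f s.
Proof. by rewrite /first; case: ex_minnP => v /eqP. Qed.

Lemma first_min s v : f v = f s -> (first s <= v)%N.
Proof. by rewrite /first; case: ex_minnP => w _ wmin /eqP/wmin. Qed.

Lemma idx_ex s : exists i, (f s < marker (first s) i)%N.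
Proof. by exists (f s).+1; apply: leq_marker. Qed.

(* Evaluated at the first occurrence of f s, so that it depends on f s only. *)
Definition idx (s : nat) : nat := ex_minn (idx_ex s).

Lemma idx_lt s : (f s < marker (first s) (idx s))%N.
Proof. by rewrite /idx; case: ex_minnP. Qed.

Lemma idx_min s i : (f s < marker (first s) i)%N -> (idx s <= i)%N.
Proof. by rewrite /idx; case: ex_minnP => w _; apply. Qed.

Lemma idx_f s s' : f s = f s' -> idx s = idx s'.
Proof.
have le v w : f v = f w -> (idx v <= idx w)%N => [vw|ss'].
  apply: idx_min; have -> : first v = first w.
    by apply/eqP; rewrite eqn_leq !first_min // f_first.
  by rewrite vw idx_lt.
by apply/eqP; rewrite eqn_leq !le.
Qed.

(** Only finitely many values lie below [m]. The bound is not effective: the induction decides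
    classically whether [m] is a value of [f]. *)
Lemma seen_eventually m : exists u, forall s, (f s < m)%N -> seen u (f s).
Proof.
elim: m => [|m [u uP]]; first by exists 0.
have [[v fv]|nfv] := pselect (exists v, f v = m); last first.
  exists u => s; rewrite ltnS leq_eqVlt => /predU1P[fs|]; last exact: uP.
  by case: nfv; exists s.
exists (maxn u v.+1) => s; rewrite ltnS leq_eqVlt => /predU1P[->|fs].
  by apply/seenP; exists v => //; rewrite leq_max ltnSn orbT.
exact: seen_mono (leq_maxl _ _) (uP s fs).
Qed.

(** Let [u] be the approximation at a stage by which all values below [m] have occurred. For
    [t >= u], everything seen by [u] is also demanded at stage [t], so [t] and the original stage
    impose the same condition and have the same minimum. *)
Lemma settle_eventually m : exists u, [/\ (m < u)%N,
  forall s, (f s < m)%N -> seen u (f s) &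
  forall t, (u <= t)%N -> settle m t = u].
Proof.
have [t0 t0P] := seen_eventually m.
have /settledP[mu uP] := settle_settled m t0.
have {uP} seen_u s : (f s < m)%N -> seen (settle m t0) (f s).
  by move=> fs; have /seenP[v vt fv] := t0P s fs; rewrite -fv uP ?fv.
exists (settle m t0); split=> // t ut; apply/eqP; rewrite eqn_leq.
rewrite !settle_min //; apply/settledP; last by split=> // s _; apply: seen_u.
have /settledP[mu' u'P] := settle_settled m t; split=> // s _ fs.
have /seenP[v vu fv] := seen_u s fs.
by rewrite -fv u'P ?fv //; apply: leq_trans ut.
Qed.

(** The markers increase, so by stage n_{i+1} the earlier ones are final; hence n_{i+1} is itself a
    threshold for both equations. *)
Lemma marker_eventually i : exists m n, [/\ (m < n)%N,
  forall s, (f s < m)%N -> seen n (f s) &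
  forall t, (n <= t)%N -> marker t i = m /\ marker t i.+1 = n].
Proof.
elim: i => [|i [m [n [mn seen_n nP]]]].
  by have [n [n0 seen_n nP]] := settle_eventually 0; exists 0, n; split=> // t /nP.
have [p [np seen_p pP]] := settle_eventually n; exists n, p; split=> // t pt.
have [_ eqn] := nP t (leq_trans (ltnW np) pt).
by split=> //; rewrite -(pP t pt) -[in RHS]eqn.
Qed.

(** Take n = n_{i+1}. A value below n unseen at n first occurs when markers i and i+1 are final. Its
    index is at most i+1, and a smaller index would put it below n_i, where all values have been
    seen by n. *)
Lemma late_idx i : exists2 n, (i < n)%N &
  forall s, (f s < n)%N -> ~~ seen n (f s) -> idx s = i.+1.
Proof.
have [m [n [mn seen_n nP]]] := marker_eventually i; exists n.
  by have [_ <-] := nP n (leqnn n); apply: leq_marker.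
move=> s fs nseen.
have nt : (n <= first s)%N.
  rewrite leqNgt; apply: contra nseen => lt; apply/seenP.
  by exists (first s); rewrite ?f_first.
have [mE nE] := nP _ nt.
apply/eqP; rewrite eqn_leq idx_min ?nE //= ltnNge.
apply: contra nseen => /(marker_homo (first s)); rewrite mE => le.
by apply/seen_n/(leq_trans (idx_lt s)).
Qed.

(* Only the parity of b matters. *)
Definition in_part (b v : nat) : bool := odd (idx v + b).

Definition part (b : nat) : set nat := [set f v | v in in_part b].

Definition part_at (b n x : nat) : bool :=
  has (fun v => (f v == x) && in_part b v) (iota 0 n).

Lemma part_atP b n x :
  reflect (exists v, [/\ (v < n)%N, f v = x & in_part b v]) (part_at b n x).
Proof.
apply: (iffP hasP) => [[v] | [v [vu fv bv]]].
  by rewrite mem_iota => /= vu /andP[/eqP fv bv]; exists v.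
by exists v; [rewrite mem_iota | rewrite fv eqxx].
Qed.

Lemma part_at_good b k : exists2 n, (k < n)%N &
  forall x, (x < n)%N -> part b x -> part_at b n x.
Proof.
(* Late values below [n] then have an index of the parity of [b], so [idx + b] is even and they miss
   [part b]. *)
have [n kn nP] := late_idx (k.*2 + ~~ odd b); exists n.
  by apply: leq_ltn_trans kn; rewrite -addnn -addnA leq_addr.
move=> x + [s bs sx]; rewrite -{x}sx => fs; have [/seenP[v vn fv]|nseen] := boolP (seen n (f s)).
  by apply/part_atP; exists v; split=> //; move: bs; rewrite /in_part (idx_f fv).
move: bs; rewrite /in_part (nP s) // oddD /= oddD odd_double /=.
by case: (odd b).
Qed.

(** * Computability of the splitting *)

Hypothesis fP : computable f.

Let recursive_f k F : recursive k F -> recursive k (fun v => f (F v)).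
Proof. by apply: recursive_app1; apply/computableE. Qed.

Lemma recursive_seen k F G :
  recursive k F -> recursive k G -> recursive k (fun v => seen (F v) (G v)).
Proof.
move=> FP GP; apply: (recursive_app2 (h := fun u x => seen u x)) => //.
apply: (recursive_has (P := fun w => f w`_0 == w`_2)%N); first exact: recursive_var.
by apply: recursive_eq; [apply: recursive_f|]; apply: recursive_var.
Qed.

Lemma recursive_settle k F G :
  recursive k F -> recursive k G -> recursive k (fun v => settle (F v) (G v)).
Proof.
move=> FP GP; apply: (recursive_app2 (h := fun m t => settle m t)) => //.
apply: (recursive_min (P := fun w => settled w`_1 w`_2 w`_0)%N) => [|v|v y].
- apply/recursive_neg/recursive_and.
    by apply: recursive_leq; [apply: recursive_succ|]; apply: recursive_var.
  apply: recursive_neg.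
  (* The list now reads [s], [u], [m], [t]: the bound variable, the candidate of the search, the two
     arguments. *)
  apply: (recursive_has
    (P := fun w => (f w`_0 < w`_2) && ~~ seen w`_1 (f w`_0))%N).
    exact: recursive_var.
  apply: recursive_and.
    by apply: recursive_leq; [apply/recursive_succ/recursive_f|]; apply: recursive_var.
  apply/recursive_neg/recursive_seen; first exact: recursive_var.
  exact/recursive_f/recursive_var.
- exact: settle_settled.
- exact: settle_min.
Qed.

Lemma recursive_idx k F : recursive k F -> recursive k (fun v => idx (F v)).
Proof.
move=> FP; apply: (recursive_app1 (h := idx)) => //.
apply: (recursive_min
  (P := fun w => f w`_1 < marker (first w`_1) w`_0)%N) => [|v|v y].
- apply/recursive_neg/recursive_leq.
    exact/recursive_succ/recursive_f/recursive_var.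
  apply: (recursive_app2 (h := marker)); last exact: recursive_var.
    apply: (recursive_iteri (st := fun w => settle w`_1 w`_2)%N).
    - exact: recursive_var.
    - exact: recursive_const.
    - by apply: recursive_settle; apply: recursive_var.
  apply: (recursive_app1 (h := first)); last exact: recursive_var.
  apply: (recursive_min (P := fun w => f w`_0 == f w`_1)%N) => [|v|v y].
  - apply/recursive_neg/recursive_eq; exact/recursive_f/recursive_var.
  - exact/eqP/f_first.
  - by move/eqP/first_min.
- exact: idx_lt.
- exact: idx_min.
Qed.

Lemma recursive_in_part b k F :
  recursive k F -> recursive k (fun v => in_part b (F v)).
Proof.
move=> FP; apply/recursive_odd/recursive_add/recursive_const.
exact: recursive_idx.
Qed.

Lemma recursive_part_at b : recursive 2 (fun v => part_at b v`_0 v`_1)%N.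
Proof.
apply: (recursive_has
  (P := fun w => (f w`_0 == w`_2) && in_part b w`_0)%N).
  exact: recursive_var.
apply: recursive_and; last exact/recursive_in_part/recursive_var.
by apply: recursive_eq; [apply: recursive_f|]; apply: recursive_var.
Qed.

Lemma part_ce b : computably_enumerable (part b).
Proof.
have [[s bs]|nex] := pselect (exists s, in_part b s); last first.
  by left; rewrite -subset0 => x [s bs _]; case: nex; exists s.
(* Values outside the part are replaced by a fixed element [f s] of it. *)
right; exists (fun v => if in_part b v then f v else f s).
  apply/computableE; have bP := recursive_in_part b (@recursive_var 1 0 isT).
  apply: eq_recursive (recursive_add
    (recursive_mul bP (recursive_f (@recursive_var 1 0 isT)))
    (recursive_mul (recursive_neg bP) (recursive_const 1 (f s)))) => v /=.
  by case: in_part; rewrite ?mul1n ?mul0n ?addn0.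
apply/seteqP; split=> [_ [v bv <-]|_ [v _ <-]].
  by exists v; rewrite // bv.
by case: ifP => bv; [exists v|exists s].
Qed.

End Splitting.

Import Order.TTheory GRing.Theory Num.Theory.
Import numFieldNormedType.Exports.
Local Open Scope ring_scope.

Lemma infinite_set_unbounded (S : set nat) :
  (forall k, exists2 n, (k <= n)%N & S n) -> infinite_set S.
Proof.
move=> SP /finite_seqP[s Ss]; have [n sn Sn] := SP (\max_(i <- s) i).+1.
have : n \in s by rewrite Ss in Sn.
by move=> /(@leq_bigmax_seq nat s xpredT id) /(_ isT); rewrite leqNgt sn.
Qed.

(** * From good stages of an enumeration to regaining approximations *)

Section SettlingTimes.
Variables (R : realType) (A : set nat) (E : nat -> nat -> bool).

(* [E n x] says that x has been enumerated into A by stage n. *)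
Hypothesis E_recursive : recursive 2 (fun v => E v`_0%N v`_1%N).
Hypothesis E_mono : forall n m x, (n <= m)%N -> E n x -> E m x.
Hypothesis E_sound : forall n x, E n x -> A x.
Hypothesis E_good :
  forall k, exists2 n, (k < n)%N & forall x, (x < n)%N -> A x -> E n x.

Let term (B : pred nat) (x : nat) : R := if B x then 2 ^- x.+1 else 0.
Let u : R^nat := series (term (fun x => `[< A x >])).
Let q (n : nat) : R := series (term (E n)) n.

Let term_ge0 B x : 0 <= term B x.
Proof. by rewrite /term; case: ifP => // _; rewrite invr_ge0 exprn_ge0. Qed.

Let le_term (B B' : pred nat) x : (B x -> B' x) -> term B x <= term B' x.
Proof.
rewrite /term; case: (B x) => [->//|_]; exact: (term_ge0 B').
Qed.

Let series_mono B : nondecreasing_seq (series (term B)).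
Proof. by apply: nondecreasing_series => n _ _; apply: term_ge0. Qed.

Let q_mono : nondecreasing_seq q.
Proof.
move=> n m nm; apply: le_trans (series_mono (E m) nm).
by apply: ler_sum => x _; apply/le_term/E_mono.
Qed.

Let u_le_set_real n : u n <= set_real R A.
Proof.
apply: nondecreasing_cvgn_le; [exact: series_mono|exact: is_cvg_set_real].
Qed.

Let q_le_set_real n : q n <= set_real R A.
Proof.
apply: le_trans (u_le_set_real n); apply: ler_sum => x _; apply: le_term.
by move=> Ex; apply/asboolP/E_sound/Ex.
Qed.

Let set_real_le n : set_real R A <= u n + 2 ^- n.
Proof.
apply: limr_le; first exact: is_cvg_set_real.
exists n => // m /= nm.
(* Keeping the slack 2^-m makes the induction work: each new term is at most half of the slack,
   which halves. *)
suff : u m <= u n + 2 ^- n - 2 ^- m.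
  by move=> /le_trans; apply; rewrite gerBl invr_ge0 exprn_ge0.
rewrite -(subnKC nm); elim: (m - n)%N => [|d IHd]; first by rewrite addn0 addrK.
rewrite addnS {1}/u seriesSr -/(u _).
apply: le_trans (lerD IHd (le_term (B' := predT) _)) _ => //.
rewrite /term -addrA lerD2l; have -> : 2 ^- (n + d) = 2 ^- (n + d).+1 *+ 2 :> R.
  by rewrite exprS invfM -[RHS]mulr_natl mulrA mulfV ?mul1r ?pnatr_eq0.
by rewrite mulr2n opprD -addrA addNr addr0.
Qed.

Let q_good n : (forall x, (x < n)%N -> A x -> E n x) ->
  set_real R A - q n <= 2 ^- n.
Proof.
move=> nP; rewrite lerBlDl; apply: le_trans (set_real_le n) _; rewrite lerD2r.
rewrite /u /q /series /= !big_mkord; apply: ler_sum => x _; apply: le_term.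
by move=> /asboolP; apply: nP.
Qed.

Let q_cvg : q n.+1 @[n --> \oo] --> set_real R A.
Proof.
apply/cvgrPdist_lt => e e0; have [k _ kP] := near_infty_natSinv_expn_lt (PosNum e0).
(* One good stage [n] beyond [k] suffices: [q] is nondecreasing and stays below the limit, so later
   errors are no larger. *)
have [n kn nP] := E_good k; exists n => // m /= nm.
rewrite ger0_norm ?subr_ge0 ?q_le_set_real //; apply: le_lt_trans (kP n (ltnW kn)).
rewrite div1r; apply: le_trans (q_good nP); rewrite lerD2l lerN2.
exact/q_mono/leqW.
Qed.

(** Horner evaluation of the binary digits [E m 0], ..., [E m (k-1)], the most significant first. *)
Let numer (m k : nat) : nat := iteri k (fun x z => z + z + E m x)%N 0.

Let numerE m k : series (term (E m)) k = (numer m k)%:R / 2 ^+ k.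
Proof.
elim: k => [|k IHk]; first by rewrite /series /= big_geq // mul0r.
rewrite seriesSr IHk /term /= natrD mulrDl; congr (_ + _).
  rewrite addnn -muln2 natrM exprS invfM mulrA -(mulrA _ 2) mulfV ?mulr1 //.
by case: (E m k); rewrite ?mul1r ?mul0r.
Qed.

(** This is 2^k - 1, because [computable_rat_seq] divides by a successor. *)
Let denom (k : nat) : nat := iteri k (fun _ z => z + z + 1)%N 0.

Let denomE k : (denom k).+1 = (2 ^ k)%N.
Proof.
by elim: k => [//|k IHk]; rewrite expnS -IHk /= mul2n -addnn addn1 addnS addSn.
Qed.

Lemma regainingly_approximable_settling :
  regainingly_approximable (set_real R A).
Proof.
(* The index shift turns the error bound 2^-(n+1) into the strict bound < 2^-n. *)
pose a n : rat := ((numer n.+1 n.+1)%:R - 0%:R) / (denom n.+1).+1%:R.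
have aE n : ratr (a n) = q n.+1.
  rewrite /q numerE /a denomE; move: (numer _ _) => N.
  by rewrite subr0 fmorph_div /= !ratr_nat natrX.
exists a; split.
- exists (fun n => numer n.+1 n.+1), (fun=> 0%N), (fun n => denom n.+1).
  split=> //; apply/computableE.
  + apply: (recursive_app1 (h := fun m => numer m m)); last first.
      exact/recursive_succ/recursive_var.
    apply: (recursive_iteri
        (st := fun w => w`_1 + w`_1 + E w`_2 w`_0)%N).
    * exact: recursive_var.
    * exact: recursive_const.
    * apply: recursive_add; first by apply: recursive_add; apply: recursive_var.
      by apply: (recursive_app2 (h := fun m x => E m x)) => //; apply: recursive_var.
  + exact: recursive_const.
  + apply: (recursive_iteri (st := fun w => w`_1 + w`_1 + 1)%N).
    * exact/recursive_succ/recursive_var.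
    * exact: recursive_const.
    * apply: recursive_add (recursive_const _ _).
      by apply: recursive_add; apply: recursive_var.
- by move=> n m nm; rewrite -(ler_rat R) !aE; apply: q_mono.
- by under eq_fun do rewrite aE; exact: q_cvg.
- apply: infinite_set_unbounded => k; have [[//|n] kn nP] := E_good k.
  exists n => //=; rewrite aE; apply: le_lt_trans (q_good nP) _.
  rewrite ltf_pV2 ?posrE ?exprn_gt0 //.
  by rewrite exprS ltr_pMl ?exprn_gt0 // ltr1n.
Qed.

End SettlingTimes.

(** * The splitting theorem *)

Lemma regainingly_approximable_set0 (R : realType) :
  regainingly_approximable_set R set0.
Proof.
split; first by left.
apply: (regainingly_approximable_settling R (E := fun _ _ => false)) => //.
  exact: recursive_const.
by move=> k; exists k.+1.
Qed.

Lemma regainingly_approximable_part (R : realType) (f : nat -> nat) (b : nat) :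
  computable f -> regainingly_approximable_set R (part f b).
Proof.
move=> fP; split; first exact: part_ce.
apply: (regainingly_approximable_settling R (E := part_at f b)).
- exact: recursive_part_at.
- move=> n m x nm /part_atP[v [vn fv bv]]; apply/part_atP; exists v.
  by split=> //; apply: leq_trans nm.
- by move=> n x /part_atP[v [_ <- bv]]; exists v.
- exact: part_at_good.
Qed.

Theorem theorem5p1 (R : realType) (C : set nat) :
  computably_enumerable C ->
  exists A B : set nat,
    [/\ regainingly_approximable_set R A,
        regainingly_approximable_set R B,
        A `&` B = set0 &
        C = A `|` B].
Proof.
case=> [->|[f fP ->]].
  exists set0, set0; rewrite setI0 setU0.
  by split=> //; apply: regainingly_approximable_set0.
(* Offset 0 selects the odd indices, offset 1 the even ones. *)
exists (part f 0), (part f 1); split; try exact: regainingly_approximable_part.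
- rewrite -subset0 => x [[v v0 fv] [w w1 fw]].
  (* Two occurrences of the same value share their index, which cannot have both parities. *)
  move: v0 w1; rewrite /in_part -(@idx_f f v w) ?fv ?fw //.
  by rewrite addn0 addn1 /= => ->.
- apply/seteqP; split=> [_ [v _ <-]|x [] [v _ <-]]; try by exists v.
  have [] := boolP (odd (idx f v)) => vP; [left|right]; exists v => //.
    by rewrite /= /in_part addn0.
  by rewrite /= /in_part addn1.
Qed.
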